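(* Let $d\ge 1$, and let $\{\rho_1,\rho_2,\dots,\rho_m\}$ be a set of $m$ pairwise distinct quantum states (density operators) on $\mathbb{C}^d$. Then there exists a virtual-cloning operation for this set, i.e. a Hermitian-preserving, trace-preserving linear map $\tilde\Lambda$ from operators on $\mathbb{C}^d$ to operators on $\mathbb{C}^d\otimes\mathbb{C}^d$ with $$\tilde\Lambda(\rho_i)=\rho_i\otimes\rho_i\qquad\text{for all } i=1,\dots,m,$$ if and only if $\rho_1,\dots,\rho_m$ are linearly independent (as elements of the real vector space of Hermitian operators on $\mathbb{C}^d$).
   Context: A quantum state (density operator) on $\mathbb{C}^d$ is a positive semidefinite operator of trace $1$. A virtual operation is a Hermitian-preserving, trace-preserving (HPTP) map: a complex-linear map between operator spaces that sends Hermitian operators to Hermitian operators and preserves the trace. A virtual-cloning operation for a set of states $\{\rho_1,\dots,\rho_m\}$ on $\mathbb{C}^d$ is an HPTP map $\tilde\Lambda$ from operators on $\mathbb{C}^d$ to operators on $\mathbb{C}^d\otimes\mathbb{C}^d$ with $\tilde\Lambda(\rho_i)=\rho_i\otimes\rho_i$ for all $i$. *)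

(* Defs.v *)
From HB Require Import structures.
From mathcomp Require Import all_boot all_order all_algebra.
From mathcomp Require Import sesquilinear spectral complex mxtens reals.

Set Implicit Arguments.
Unset Strict Implicit.
Unset Printing Implicit Defensive.

Import Order.TTheory GRing.Theory Num.Theory.

Local Open Scope ring_scope.
Local Open Scope complex_scope.
Local Open Scope sesquilinear_scope.

(* Operators on C^d are matrices over R[i], where R is the field of real
   numbers.  On R[i], [0 <= z] means that z is real and nonnegative. *)

Definition psdmx (R : realType) (d : nat) (A : 'M[R[i]]_d) : Prop :=
  A \is hermsymmx /\ forall v : 'cV[R[i]]_d, 0 <= (v ^t* *m A *m v) 0 0.

Definition quantum_state (R : realType) (d : nat) (A : 'M[R[i]]_d) : Prop :=
  psdmx A /\ \tr A = 1.

Definition hermitian_preserving (R : realType) (n p : nat)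
    (L : {linear 'M[R[i]]_n -> 'M[R[i]]_p}) : Prop :=
  forall X : 'M[R[i]]_n, X \is hermsymmx -> L X \is hermsymmx.

Definition trace_preserving (R : realType) (n p : nat)
    (L : {linear 'M[R[i]]_n -> 'M[R[i]]_p}) : Prop :=
  forall X : 'M[R[i]]_n, \tr (L X) = \tr X.

Definition virtual_operation (R : realType) (n p : nat)
    (L : {linear 'M[R[i]]_n -> 'M[R[i]]_p}) : Prop :=
  hermitian_preserving L /\ trace_preserving L.

(* C^d (x) C^d is identified with C^(d * d) through the Kronecker product. *)
Definition virtual_cloning (R : realType) (d m : nat)
    (rho : 'I_m -> 'M[R[i]]_d)
    (L : {linear 'M[R[i]]_d -> 'M[R[i]]_(d * d)}) : Prop :=
  virtual_operation L /\ forall i : 'I_m, L (rho i) = rho i *t rho i.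

(* Linear independence over the reals.  The scalars c i range over R and act
   through the embedding R -> R[i], since the canonical module structure on
   'M[R[i]]_d is the complex one. *)
Definition real_linearly_independent (R : realType) (d m : nat)
    (rho : 'I_m -> 'M[R[i]]_d) : Prop :=
  forall c : 'I_m -> R,
    \sum_(i < m) (c i)%:C *: rho i = 0 -> forall i : 'I_m, c i = 0.

(* Main.v *)
Require Import Defs.
From HB Require Import structures.
From mathcomp Require Import all_boot all_order all_algebra.
From mathcomp Require Import complex reals.
From mathcomp Require Import sesquilinear spectral mxtens.

(** If [L] clones the [rho_i], applying [L] to a relation [sum_i c_i rho_i = 0]
    and taking a matrix entry of the second tensor factor shows that
    [(c_i * (rho_i)_ab)_i] is again a relation.  Hence so is
    [(c_i * ((rho_i)_ab - (rho_j)_ab))_i], and as the [rho_i] are distinct, such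
    steps kill every coefficient except a chosen one, which must then vanish.
    Conversely, independent [rho_i] have dual functionals, which give a linear
    map cloning them; the trace defect is put on a fixed operator of trace 1,
    and averaging [L] with its conjugate under the adjoint restores Hermitian
    preservation. *)

Set Implicit Arguments.
Unset Strict Implicit.
Unset Printing Implicit Defensive.

Import GRing.Theory Num.Theory.
Local Open Scope ring_scope.
Local Open Scope sesquilinear_scope.

Lemma hermsymmxP (C : numClosedFieldType) n (A : 'M[C]_n) :
  reflect (A ^t* = A) (A \is hermsymmx).
Proof.
apply: (iffP (is_hermitianmxP _ _ _)); rewrite expr0 scale1r; exact: esym.
Qed.

Lemma adjmxD (C : numClosedFieldType) m n (A B : 'M[C]_(m, n)) :
  (A + B) ^t* = A ^t* + B ^t*.
Proof. by rewrite linearD map_mxD. Qed.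

Lemma adjmxZ (C : numClosedFieldType) m n (c : C) (A : 'M[C]_(m, n)) :
  (c *: A) ^t* = c^* *: A ^t*.
Proof. by rewrite linearZ map_mxZ. Qed.

Lemma adjmx_tens (C : numClosedFieldType) m n p q
    (A : 'M[C]_(m, n)) (B : 'M[C]_(p, q)) : (A *t B) ^t* = A ^t* *t B ^t*.
Proof. by rewrite trmx_tens map_mxT. Qed.

Lemma mxtrace_adj (C : numClosedFieldType) n (A : 'M[C]_n) :
  \tr (A ^t*) = (\tr A)^*.
Proof. by rewrite -map_trmx mxtrace_tr trace_map_mx. Qed.

Lemma mxtrace_tens (K : comNzRingType) m n (A : 'M[K]_m) (B : 'M[K]_n) :
  \tr (A *t B) = \tr A * \tr B.
Proof. by rewrite /mxtrace mulr_sum; apply: eq_bigr => i _; rewrite mxE. Qed.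

Section CloningRelations.
Variables (F : fieldType) (d m : nat) (rho : 'I_m -> 'M[F]_d).

Lemma cloning_relation_mul (L : {linear 'M[F]_d -> 'M[F]_(d * d)})
    (c : 'I_m -> F) (a b : 'I_d) :
  (forall i, L (rho i) = rho i *t rho i) ->
  \sum_i c i *: rho i = 0 -> \sum_i (c i * rho i a b) *: rho i = 0.
Proof.
move=> Lrho /(congr1 L); rewrite linear0 linear_sum => Lc.
apply/matrixP => p q.
(* The entry of [rho i *t rho i] in row [(p, a)] and column [(q, b)] is [rho i p q * rho i a b]:
   fixing [a], [b] leaves a multiple of [rho i]. *)
move/matrixP/(_ (mxtens_index (p, a)) (mxtens_index (q, b))): Lc.
rewrite summxE mxE => Lc; rewrite summxE [RHS]mxE.
apply: etrans Lc; apply: eq_bigr => i _.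
by rewrite linearZ /= Lrho !mxE !mxtens_indexK /= -mulrA [rho i a b * _]mulrC.
Qed.

Lemma cloning_linear_independent (L : {linear 'M[F]_d -> 'M[F]_(d * d)})
    (c : 'I_m -> F) :
  (forall i, L (rho i) = rho i *t rho i) ->
  injective rho -> (forall i, rho i != 0) ->
  \sum_i c i *: rho i = 0 -> forall k, c k = 0.
Proof.
move=> Lrho rho_inj rho_neq0 relc k; apply/eqP/negPn/negP => ck.
(* Induction on the set [s] of coefficients to remove, keeping the one at [k] nonzero. *)
have kill (s : seq 'I_m) : k \notin s -> exists2 e : 'I_m -> F,
    \sum_i e i *: rho i = 0 & e k != 0 /\ forall j, j \in s -> e j = 0.
  elim: s => [_|j s IHs]; first by exists c.
  rewrite inE negb_or => /andP[kj /IHs[e rele [ek es]]].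
  have /existsP[a /existsP[b rab]] :
      [exists a, exists b, rho k a b != rho j a b].
    apply: contraR kj => /existsPn eq_rho; apply/eqP/rho_inj/matrixP => a b.
    by have /existsPn/(_ b)/negPn/eqP := eq_rho a.
  (* The factor [rho i a b - rho j a b] vanishes at [i = j] but not at [i = k], and preserves the
     zeros already obtained. *)
  exists (fun i => e i * rho i a b - rho j a b * e i).
    under eq_bigr do rewrite scalerBl -[(rho j a b * _) *: _]scalerA.
    rewrite sumrB -scaler_sumr rele scaler0 subr0.
    exact: cloning_relation_mul rele.
  split=> [|l]; first by rewrite mulrC -mulrBl mulf_neq0 // subr_eq0.
  rewrite inE mulrC -mulrBl => /orP[/eqP->|/es->]; last by rewrite mulr0.
  by rewrite subrr mul0r.
(* With every other index removed, the relation reads [e k *: rho k = 0]. *)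
have [|e rele [ek e0]] := kill (enum (predC1 k)).
  by rewrite mem_enum !inE eqxx.
move: rele; rewrite (bigD1 k) //= big1 => [|i ik].
  by move/eqP; rewrite addr0 scaler_eq0 (negPf ek) (negPf (rho_neq0 k)).
by rewrite e0 ?scale0r // mem_enum.
Qed.

End CloningRelations.

Lemma linear_interpolation (F : fieldType) n p m (A : 'I_m -> 'M[F]_n)
    (Y : 'I_m -> 'M[F]_p) (S : 'M[F]_p) :
  (forall c : 'I_m -> F, \sum_i c i *: A i = 0 -> forall i, c i = 0) ->
  \tr S = 1 -> (forall i, \tr (Y i) = \tr (A i)) ->
  exists L : {linear 'M[F]_n -> 'M[F]_p},
    (forall X, \tr (L X) = \tr X) /\ forall i, L (A i) = Y i.
Proof.
move=> indepA trS trY; pose M := \matrix_i mxvec (A i).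
have freeM : row_free M.
  rewrite -kermx_eq0; apply/eqP/row_matrixP => k; rewrite row0.
  have : row k (kermx M) *m M = 0 by rewrite -row_mul mulmx_ker row0.
  (* A vector in the left kernel of [M] is the coefficient list of a relation among the [A i]. *)
  move: (row k _) => v vM; apply/rowP => i; rewrite mxE.
  apply: (indepA (v 0)); apply: (can_inj mxvecK).
  rewrite linear0 linear_sum -[RHS]vM mulmx_sum_row.
  by apply: eq_bigr => j _; rewrite linearZ rowK.
have [B MB] := row_freeP freeM.
(* Since [M *m B = 1], the columns of [B] are functionals dual to the vectorised [A i]. *)
pose dual i X := (mxvec X *m B) 0 i.
have dualA i j : dual i (A j) = (j == i)%:R.
  by rewrite /dual -[mxvec _](rowK (fun j => mxvec (A j))) -row_mul MB !mxE.
(* Each [Y i - \tr (A i) *: S] is traceless, so the trace of [f X] comes from [\tr X *: S] alone; at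
   [A i] the two multiples of [S] cancel. *)
pose f X := \sum_i dual i X *: (Y i - \tr (A i) *: S) + \tr X *: S.
have f_lin : linear f.
  move=> a X Z; rewrite /f linearP /= scalerDl scalerDr -scalerA.
  rewrite addrACA; congr (_ + _); rewrite scaler_sumr -big_split.
  apply: eq_bigr => i _ /=.
  by rewrite /dual linearP mulmxDl -scalemxAl !mxE scalerDl scalerA.
pose lin := GRing.isLinear.Build F 'M[F]_n 'M[F]_p *:%R f f_lin.
pose L : {linear 'M[F]_n -> 'M[F]_p} := HB.pack f lin.
exists L; split=> [X|i]; rewrite /L /= /f.
  rewrite linearD linearZ /= trS mulr1 linear_sum big1 ?add0r // => i _.
  by rewrite linearZ /= linearB linearZ /= trS mulr1 trY subrr mulr0.
rewrite (bigD1 i) //= big1 => [|j ji].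
  by rewrite dualA eqxx scale1r addr0 subrK.
by rewrite dualA eq_sym (negPf ji) scale0r.
Qed.

Local Open Scope complex_scope.

Lemma hermitian_symmetrization (R : realType) n p
    (L0 : {linear 'M[R[i]]_n -> 'M[R[i]]_p}) :
  trace_preserving L0 -> exists L : {linear 'M[R[i]]_n -> 'M[R[i]]_p},
    virtual_operation L /\ forall X, X \is hermsymmx ->
      L0 X \is hermsymmx -> L X = L0 X.
Proof.
(* The second summand is linear because the two conjugations of scalars cancel. *)
move=> trL0; pose f X := 2^-1 *: (L0 X + (L0 (X ^t*)) ^t*).
have f_lin : linear f.
  move=> a X Z; rewrite /f adjmxD adjmxZ !linearP /= map_mxD map_mxZ /= conjCK.
  by rewrite addrACA -[a *: _ + _]scalerDr [LHS]scalerDr !scalerA mulrC.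
pose lin := GRing.isLinear.Build R[i] 'M[R[i]]_n 'M[R[i]]_p *:%R f f_lin.
pose L : {linear 'M[R[i]]_n -> 'M[R[i]]_p} := HB.pack f lin.
have half (V : lmodType R[i]) (x : V) : 2^-1 *: (x + x) = x.
  by rewrite -mulr2n -[x *+ 2]scaler_nat scalerA mulVf ?scale1r // pnatr_eq0.
exists L; split; first split.
- move=> X /hermsymmxP HX; apply/hermsymmxP; rewrite /L /= /f HX.
  by rewrite adjmxZ adjmxD trmxCK addrC fmorphV rmorph_nat.
- move=> X; rewrite /L /= /f linearZ linearD /= mxtrace_adj !trL0.
  by rewrite mxtrace_adj conjCK; apply: (half R[i]^o).
- by move=> X /hermsymmxP HX /hermsymmxP HL; rewrite /L /= /f HX HL half.
Qed.

(** The adjoint of a relation among Hermitian matrices is the relation with conjugate coefficients,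
    so real and imaginary parts of the coefficients each give a real relation. *)
Lemma hermitian_complex_independent (R : realType) d m
    (rho : 'I_m -> 'M[R[i]]_d) (c : 'I_m -> R[i]) :
  (forall i, rho i \is hermsymmx) -> real_linearly_independent rho ->
  \sum_i c i *: rho i = 0 -> forall i, c i = 0.
Proof.
move=> Hrho indep relc.
have relJ : \sum_i (c i)^*%C *: rho i = 0.
  transitivity ((\sum_i c i *: rho i) ^t*); last by rewrite relc trmx0 map_mx0.
  rewrite !raddf_sum; apply: eq_bigr => i _ /=.
  by rewrite adjmxZ (hermsymmxP _ (Hrho i)).
have reRe : \sum_i (complex.Re (c i))%:C *: rho i = 0.
  transitivity (2^-1 *: \sum_i (c i *: rho i + (c i)^*%C *: rho i)).
    rewrite scaler_sumr; apply: eq_bigr => i _.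
    by rewrite ReJ_add mulrC -scalerA scalerDl.
  by rewrite big_split /= relc relJ addr0 scaler0.
have reIm : \sum_i (complex.Im (c i))%:C *: rho i = 0.
  (* The constant comes from [Im z = i (z^* - z) / 2]. *)
  transitivity ((2^-1 * 'i%C) *: \sum_i ((c i)^*%C *: rho i - c i *: rho i)).
    rewrite scaler_sumr; apply: eq_bigr => i _.
    by rewrite ImJ_sub -scalerBl scalerA -mulrA mulrC.
  by rewrite sumrB relc relJ subr0 scaler0.
by move=> i; rewrite [c i]complexE (indep _ reRe) (indep _ reIm) mulr0 addr0.
Qed.

Theorem theorem1 (R : realType) (d : nat) (hd : (1 <= d)%N) (m : nat)
    (rho : 'I_m -> 'M[R[i]]_d)
    (hrho : forall i : 'I_m, quantum_state (rho i))
    (hdistinct : forall i j : 'I_m, i <> j -> rho i <> rho j) :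
  (exists L : {linear 'M[R[i]]_d -> 'M[R[i]]_(d * d)},
      virtual_cloning rho L)
  <-> real_linearly_independent rho.
Proof.
have Hrho i : rho i \is hermsymmx by have [[]] := hrho i.
have trrho i : \tr (rho i) = 1 by have [] := hrho i.
split=> [[L [_ Lrho]] c relc k|indep].
  have rho_inj : injective rho.
    by move=> i j eq_ij; apply/eqP/negPn/negP => /eqP/hdistinct/(_ eq_ij).
  have rho_neq0 i : rho i != 0.
    apply/eqP => rho0; have := trrho i.
    by rewrite rho0 mxtrace0 => /esym/eqP; rewrite oner_eq0.
  by have [] := cloning_linear_independent Lrho rho_inj rho_neq0 relc k.
have [S trS] : exists S : 'M[R[i]]_(d * d), \tr S = 1.
  (* Writing [d] as a successor provides the index [0] for a matrix unit of trace 1. *)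
  case: d hd {rho hrho hdistinct Hrho trrho indep} => // d' _.
  exists (delta_mx 0 0); rewrite /mxtrace (bigD1 0) //= big1 => [|j /negPf j0].
    by rewrite mxE eqxx addr0.
  by rewrite mxE j0.
have [|L0 [trL0 L0rho]] := linear_interpolation
    (fun c => hermitian_complex_independent Hrho indep) trS
    (Y := fun i => rho i *t rho i).
  by move=> i; rewrite mxtrace_tens !trrho mulr1.
have [L [LV LE]] := hermitian_symmetrization trL0.
(* Symmetrizing keeps the prescribed values, as [rho i] and [rho i *t rho i] are both Hermitian. *)
exists L; split=> // i; rewrite -L0rho; apply: LE => //.
apply/hermsymmxP; rewrite L0rho adjmx_tens.
by rewrite (hermsymmxP _ (Hrho i)).
Qed.
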